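(* Let $V:\Omega\to[1,\infty)$ be measurable, $\varphi$ an admissible rate function, and $S$ a stochastic operator on $\mathcal M_V$ such that: (1) there exist $K>0$ and $0<\varsigma<1$ with $\|S\mu\|_V+\varsigma\|\mu\|_{\varphi(V)}\le\|\mu\|_V+K\|\mu\|$ for all $\mu\in\mathcal M_V$; (2) for some integer $N\ge1$ there exist $0<\gamma_H<1$ and $A>K/\varsigma$ such that for every $\nu\in\mathcal N_{\varphi(V)}$ with $\|\nu\|_{\varphi(V)}\le A\|\nu\|$ one has $\|S^N\nu\|\le\gamma_H\|\nu\|$. Then $S$ has an equilibrium $\mu^*\in\mathcal P_{\varphi(V)}$, i.e. $S\mu^*=\mu^*$.
   Context: Let $(\Omega,\mathcal E)$ be a measurable space. $\mathcal M$ denotes the space of finite signed measures on $\Omega$, $\mathcal P\subset\mathcal M$ the set of probability measures, and $\mathcal N=\{\nu\in\mathcal M:\nu(\Omega)=0\}$. For $\mu\in\mathcal M$ with Hahn–Jordan decomposition $\mu=\mu_+-\mu_-$, $|\mu|=\mu_++\mu_-$ and $\|\mu\|=\int_\Omega d|\mu|$ is the total variation norm. For a measurable $W:\Omega\to[1,\infty)$, $\|\mu\|_W=\int_\Omega W\,d|\mu|$, $\mathcal M_W=\{\mu\in\mathcal M:\|\mu\|_W<\infty\}$, $\mathcal P_W=\mathcal P\cap\mathcal M_W$, $\mathcal N_W=\mathcal N\cap\mathcal M_W$. A stochastic operator is a linear map $S:\mathcal M\to\mathcal M$ with $S(\mathcal P)\subseteq\mathcal P$; it is a stochastic operator on $\mathcal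 M_W$ if moreover $S(\mathcal M_W)\subseteq\mathcal M_W$ and the restriction is bounded for $\|\cdot\|_W$. An admissible rate function is a concave function $\varphi:[1,\infty)\to[1,\infty)$ with $\varphi(1)=1$ and $\varphi(v)/v\to0$ as $v\to\infty$; $\varphi(V)$ denotes the composition $\varphi\circ V$. An equilibrium of $S$ is a $\mu\in\mathcal P$ with $S\mu=\mu$. *)

(* Defs.v *)
From HB Require Import structures.
From mathcomp Require Import all_boot all_order all_algebra.
From mathcomp Require Import all_classical all_reals all_analysis.
Set Implicit Arguments. Unset Strict Implicit. Unset Printing Implicit Defensive.
Import Order.TTheory GRing.Theory Num.Theory.
Import numFieldNormedType.Exports.
Local Open Scope classical_set_scope.
Local Open Scope ring_scope.
Local Open Scope ereal_scope.

(** Finite signed measures on a measurable space are MathComp-Analysis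
    charges [{charge set T -> \bar R}] (finite-valued, sigma-additive).  Two
    charges represent the same signed measure iff they agree on measurable
    sets (values on non-measurable sets are irrelevant). *)

Section signed_measures.
Context d (T : measurableType d) (R : realType).

Notation sm := (charge T R).

Definition sm_eq (mu nu : sm) : Prop :=
  forall A, measurable A -> mu A = nu A.

Definition hahnP (mu : sm) : set T :=
  projT1 (cid (Hahn_decomposition mu)).
Definition hahnN (mu : sm) : set T :=
  projT1 (cid (projT2 (cid (Hahn_decomposition mu)))).
Definition hahnPN (mu : sm) : hahn_decomposition mu (hahnP mu) (hahnN mu) :=
  projT2 (cid (projT2 (cid (Hahn_decomposition mu)))).

Definition tvar (mu : sm) := charge_variation (hahnPN mu).

Definition wnorm (W : T -> R) (mu : sm) : \bar R :=
  \int[tvar mu]_x (W x)%:E.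

Definition tvnorm (mu : sm) : \bar R := tvar mu setT.

Definition in_MW (W : T -> R) (mu : sm) : Prop := wnorm W mu < +oo.

Definition is_prob (mu : sm) : Prop :=
  (forall A, measurable A -> 0 <= mu A) /\ mu setT = 1.

Definition is_null_mass (mu : sm) : Prop := mu setT = 0.

Definition lincomb (a b : R) (mu nu : sm) : sm :=
  cadd (cscale a mu) (cscale b nu).

Definition stochastic_op (S : sm -> sm) : Prop :=
  (forall (a b : R) (mu nu lam : sm), sm_eq lam (lincomb a b mu nu) ->
      sm_eq (S lam) (lincomb a b (S mu) (S nu)))
  /\ (forall mu, is_prob mu -> is_prob (S mu)).

Definition stochastic_op_on (W : T -> R) (S : sm -> sm) : Prop :=
  stochastic_op S
  /\ (forall mu, in_MW W mu -> in_MW W (S mu))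
  /\ (exists C : R, forall mu, in_MW W mu -> wnorm W (S mu) <= C%:E * wnorm W mu).

Definition equilibrium (S : sm -> sm) (mu : sm) : Prop :=
  is_prob mu /\ sm_eq (S mu) mu.

End signed_measures.

Definition admissible_rate {R : realType} (phi : R -> R) : Prop :=
  (forall x y t : R, (1 <= x)%R -> (1 <= y)%R -> (0 <= t <= 1)%R ->
      (t * phi x + (1 - t) * phi y <= phi (t * x + (1 - t) * y))%R)
  /\ (forall x : R, (1 <= x)%R -> (1 <= phi x)%R)
  /\ phi 1%R = 1%R
  /\ (phi v / v)%R @[v --> +oo%R] --> (0 : R)%R.

(* Main.v *)
(** Let [mu] be a Dirac mass, [nu = S mu - mu], and write [a k], [b k], [v k] for
    the total variation, [phi(V)]- and [V]-norms of [S^k nu].  With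
    [alpha = K / (1 - gammaH)], the functional
    [L k = v k + alpha * (a k + ... + a (k + N - 1))] satisfies
    [L (k+1) + (varsigma - K / A) * b k <= L k]: if [b k <= A * a k], the
    contraction [a (k + N) <= gammaH * a k] absorbs the term [K * a k] of the
    drift inequality; otherwise [K * a k < (K / A) * b k].  Hence [sum_k b k] is
    finite, the increments [S^(k+1) mu - S^k mu = S^k nu] are summable in the
    [phi(V)]-norm, and [mu + sum_k S^k nu] is a probability measure, fixed by [S]
    because [S] does not increase the total variation norm. *)
Require Import Defs.
From HB Require Import structures.
From mathcomp Require Import all_boot all_order all_algebra.
From mathcomp Require Import all_classical all_reals all_analysis.
From mathcomp Require Import measurable_realfun ring lra.
Set Implicit Arguments. Unset Strict Implicit. Unset Printing Implicit Defensive.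
Import Order.TTheory GRing.Theory Num.Theory.
Import numFieldNormedType.Exports.
Local Open Scope classical_set_scope.
Local Open Scope ring_scope.

(** * Rate functions and a Lyapunov estimate for real sequences *)

Section real_lemmas.
Context {R : realType}.

Lemma admissible_rate_nondecreasing (phi : R -> R) :
  admissible_rate phi -> {in [pred x | 1 <= x] &, nondecreasing phi}.
Proof.
move=> [phi_concave [phi_ge1 _]] x y; rewrite !inE => x1 y1 xy.
rewrite leNgt; apply/negP => phi_yx.
have xy' : x < y.
  by rewrite lt_neqAle xy andbT; apply/eqP => E; rewrite E ltxx in phi_yx.
pose dl := phi x - phi y.
have dl0 : 0 < dl by rewrite subr_gt0.
(* By concavity the slope beyond [y] is at most the negative slope on
   [[x, y]], so [phi] would drop below [1] far enough to the right. *)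
pose s := phi y / dl.
have phiy1 := phi_ge1 _ y1.
have s0 : 0 < s by rewrite divr_gt0//; lra.
(* The line through the graph points at [x] and [y] vanishes at [z], as [phi y - s * dl = 0];
   concavity then forces [phi z <= 0]. *)
pose z := y + s * (y - x).
have z1 : 1 <= z by rewrite (le_trans y1)// lerDl mulr_ge0 ?subr_ge0// ltW.
have s1 : 0 < 1 + s by lra.
pose t := s / (1 + s).
have t01 : 0 <= t <= 1.
  by rewrite /t divr_ge0 ?(ltW s0) ?(ltW s1)//= ler_pdivrMr//; lra.
have yE : y = t * x + (1 - t) * z.
  by rewrite /z /t; field; rewrite gt_eqF.
have := phi_concave x z t x1 z1 t01; rewrite -yE => c.
have phiz1 := phi_ge1 _ z1.
have {}c : s * phi x + phi z <= (1 + s) * phi y.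
  have : (1 + s) * (t * phi x + (1 - t) * phi z) <= (1 + s) * phi y.
    by rewrite ler_pM2l.
  suff -> : (1 + s) * (t * phi x + (1 - t) * phi z) = s * phi x + phi z by [].
  by rewrite /t; field; rewrite gt_eqF.
have sd : s * dl = phi y by rewrite /s divfK // gt_eqF.
move: sd; rewrite /dl mulrBr => sd; lra.
Qed.

Lemma admissible_rate_measurable_comp d (T : measurableType d) (phi : R -> R)
    (V : T -> R) :
  admissible_rate phi -> measurable_fun setT V -> (forall x, 1 <= V x) ->
  measurable_fun setT (phi \o V).
Proof.
move=> phiP mV V1.
(* Monotonicity is known only on [[1, +oo)]. Truncating the argument below at 1 makes the function
   monotone on the whole line and leaves the composition with [V] unchanged. *)
have -> : phi \o V = (fun v => phi (Num.max 1 v)) \o V.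
  by apply/funext => x /=; rewrite (max_idPr _).
apply: measurableT_comp => //; apply: nondecreasing_measurable => // v w vw.
apply: admissible_rate_nondecreasing => //; rewrite ?inE.
- by rewrite le_max lexx.
- by rewrite le_max lexx.
- by rewrite ge_max !le_max lexx vw orbT.
Qed.

Lemma lyapunov_summable (a b v : nat -> R) (K s A g : R) (N : nat) :
  0 < K -> 0 < s -> K / s < A -> 0 < g < 1 ->
  (forall k, 0 <= a k) -> (forall k, 0 <= b k) -> (forall k, 0 <= v k) ->
  (forall k, v k.+1 + s * b k <= v k + K * a k) ->
  (forall k, a k.+1 <= a k) ->
  (forall k, b k <= A * a k -> a (N + k)%N <= g * a k) ->
  exists M, forall n, \sum_(0 <= k < n) b k <= M.
Proof.
move=> K0 s0 KA /andP[g0 g1] a0 b0 v0 drift aS harris.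
have A0 : 0 < A by apply: lt_trans KA; rewrite divr_gt0.
have a_nincr k n : a (n + k)%N <= a k.
  by elim: n => [|n IH]; rewrite ?add0n// addSn (le_trans (aS _)).
pose s' := s - K / A.
have s'0 : 0 < s'.
  by rewrite subr_gt0 ltr_pdivrMr// mulrC -ltr_pdivrMr.
have s's : s' <= s by rewrite lerBlDr lerDl divr_ge0// ltW.
pose alpha := K / (1 - g).
have alpha0 : 0 <= alpha by rewrite divr_ge0 ?ltW// subr_gt0.
have alphaE : alpha * (1 - g) = K by rewrite divfK// subr_eq0 gt_eqF.
pose L k := v k + alpha * \sum_(0 <= j < N) a (j + k)%N.
have L0 k : 0 <= L k by rewrite addr_ge0// mulr_ge0// sumr_ge0.
(* Sliding the window by one index gains its new last term and loses its first, so [L] changes by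
   [alpha * (a (N + k) - a k)] besides the change of [v]. *)
have shift k : \sum_(0 <= j < N) a (j + k.+1)%N =
    \sum_(0 <= j < N) a (j + k)%N + a (N + k)%N - a k.
  rewrite (eq_bigr (fun j => a (j.+1 + k)%N)); last first.
    by move=> j _; rewrite addnS addSn.
  rewrite -big_nat_recr//= big_nat_recl//= add0n; ring.
have LS k : L k.+1 + s' * b k <= L k.
  rewrite /L shift.
  have dk := drift k.
  have [bA|bA] := leP (b k) (A * a k).
  - have ak := harris k bA.
    have : alpha * (a (N + k)%N - a k) <= - K * a k.
      have -> : - K * a k = alpha * (g * a k - a k) by rewrite -alphaE; ring.
      by rewrite ler_wpM2l// lerB.
    have : s' * b k <= s * b k by rewrite ler_wpM2r.
    lra.
  - have ak : K * a k <= K / A * b k.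
      by rewrite -mulrA ler_pM2l// mulrC ler_pdivlMr// mulrC ltW.
    (* Without contraction the window sum still does not grow, since [a] is nonincreasing. *)
    have : alpha * (a (N + k)%N - a k) <= 0.
      by rewrite mulr_ge0_le0// subr_le0.
    rewrite /s'; lra.
(* Telescoping [LS] and discarding [L n >= 0] gives this bound. *)
exists (L 0%N / s') => n; rewrite ler_pdivlMr// mulrC.
have : L n + s' * \sum_(0 <= k < n) b k <= L 0%N; last by have := L0 n; lra.
elim: n => [|n IH]; first by rewrite big_nil mulr0 addr0.
by rewrite big_nat_recr//= mulrDr; have := LS n; lra.
Qed.

End real_lemmas.

(** * Variation, weighted norms and series of charges *)

Section signed_measure_lemmas.
Context d (T : measurableType d) (R : realType).
Local Open Scope ereal_scope.
Notation sm := (charge T R).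
Implicit Types (mu nu : sm) (W : T -> R).

Lemma fin_num_sube_eq0 (x y : \bar R) : x \is a fin_num -> y \is a fin_num ->
  x - y = 0 -> x = y.
Proof.
by case: x => [x| |]//; case: y => [y| |]// _ _ [] /subr0_eq ->.
Qed.

Lemma lincombE (a b : R) mu nu B :
  lincomb a b mu nu B = a%:E * mu B + b%:E * nu B.
Proof. by []. Qed.

Lemma cscaleE (a : R) mu B : (cscale a mu : sm) B = a%:E * mu B.
Proof. by []. Qed.

Lemma measurable_hahnP mu : measurable (hahnP mu).
Proof. by have [[]] := hahnPN mu. Qed.

Lemma measurable_hahnN mu : measurable (hahnN mu).
Proof. by have [_ []] := hahnPN mu. Qed.

Lemma tvarE mu B : measurable B ->
  tvar mu B = mu (B `&` hahnP mu) - mu (B `&` hahnN mu).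
Proof.
move=> mB; rewrite /tvar /charge_variation jordan_posE cjordan_posE.
by rewrite jordan_negE cjordan_negE /crestr0 mem_set.
Qed.

Lemma fin_num_tvnorm mu : tvnorm mu \is a fin_num.
Proof. exact: fin_num_measure. Qed.

Lemma tvnorm_ge0 mu : 0 <= tvnorm mu.
Proof. by rewrite /tvnorm; exact: measure_ge0. Qed.

Lemma abse_le_tvnorm mu B : measurable B -> `|mu B| <= tvnorm mu.
Proof.
move=> mB; apply: le_trans (abse_charge_variation (hahnPN mu) mB) _.
by apply: le_measure => //; rewrite inE.
Qed.

(** Cutting [B] along the Hahn sets writes its variation as [mu] of one piece plus [- mu] of the
    other, and [m] bounds each. Norms of sums and limits can thus be estimated setwise, without
    knowing their Hahn decompositions. *)
Lemma tvar_le_measure mu (m : measure T R) B :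
  (forall C, measurable C -> `|mu C| <= m C) -> measurable B ->
  tvar mu B <= m B.
Proof.
move=> mum mB; have [_ _ PN PN0] := hahnPN mu.
have [mP mN] := (measurable_hahnP mu, measurable_hahnN mu).
rewrite tvarE// -[X in _ <= m X]setIT -PN setIUr measureU//;
  [|exact: measurableI|exact: measurableI|by rewrite setIACA PN0 setI0].
apply: leeD; apply: le_trans (mum _ _); rewrite ?lee_abs//; try exact: measurableI.
by rewrite -abseN lee_abs.
Qed.

Lemma wnorm_le_measure W mu (m : measure T R) :
  measurable_fun setT W -> (forall x, (0 <= W x)%R) ->
  (forall B, measurable B -> `|mu B| <= m B) ->
  wnorm W mu <= \int[m]_x (W x)%:E.
Proof.
move=> mW W0 mum; apply: ge0_le_measure_integral => //.
- by move=> B; exact: tvar_le_measure.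
- exact/measurable_EFinP.
Qed.

Lemma wnorm_le_add W mu mu1 mu2 :
  measurable_fun setT W -> (forall x, (0 <= W x)%R) ->
  (forall B, measurable B -> `|mu B| <= `|mu1 B| + `|mu2 B|) ->
  wnorm W mu <= wnorm W mu1 + wnorm W mu2.
Proof.
move=> mW W0 mu12; rewrite /wnorm -ge0_integral_measure_add//;
  [|by move=> x _; rewrite lee_fin|exact/measurable_EFinP].
apply: wnorm_le_measure => // B mB.
rewrite [leRHS]measure_addE (le_trans (mu12 _ mB))// leeD//;
  exact: abse_charge_variation.
Qed.

Lemma wnorm_ge0 W mu : (forall x, (0 <= W x)%R) -> 0 <= wnorm W mu.
Proof. by move=> W0; apply: integral_ge0 => x _; rewrite lee_fin. Qed.

Lemma tvnorm_le_wnorm W mu : measurable_fun setT W -> (forall x, (1 <= W x)%R) ->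
  tvnorm mu <= wnorm W mu.
Proof.
move=> mW W1; rewrite /tvnorm /wnorm -[leLHS]mul1e -integral_cst//.
apply: ge0_le_integral => //; first exact/measurable_EFinP.
by move=> x _; rewrite lee_fin.
Qed.

(* The sum of an absolutely convergent series of charges is the difference of
   the sums of the positive and of the negative parts, both finite measures. *)
Lemma charge_series (c : nat -> sm) :
  \sum_(0 <= k <oo) tvnorm (c k) < +oo ->
  exists nu : sm, forall n B, measurable B ->
    `|nu B - \sum_(0 <= k < n) c k B| <= mseries (fun k => tvar (c k)) n B.
Proof.
move=> c_summable.
pose p k : measure T R := jordan_pos (hahnPN (c k)).
pose q k : measure T R := jordan_neg (hahnPN (c k)).
have p_fin k B : measurable B -> p k B \is a fin_num.
  by move=> mB; exact: fin_num_measure.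
have q_fin k B : measurable B -> q k B \is a fin_num.
  by move=> mB; exact: fin_num_measure.
have mseries_fin (m : nat -> measure T R) : (forall k, m k setT <= tvnorm (c k)) ->
    fin_num_fun (mseries m 0).
  move=> m_tv B mB; rewrite ge0_fin_numE//; apply: le_lt_trans c_summable.
  apply: lee_nneseries => // k _; apply: le_trans (m_tv k).
  by apply: le_measure => //; rewrite inE.
have p_sum_fin : fin_num_fun (mseries p 0).
  by apply: mseries_fin => k; rewrite /tvnorm /tvar /charge_variation leeDl.
have q_sum_fin : fin_num_fun (mseries q 0).
  by apply: mseries_fin => k; rewrite /tvnorm /tvar /charge_variation leeDr.
pose Pf := Measure_isFinite.Build d T R (mseries p 0) p_sum_fin.
pose Qf := Measure_isFinite.Build d T R (mseries q 0) q_sum_fin.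
pose Pm : {finite_measure set T -> \bar R}%R := HB.pack (mseries p 0) Pf.
pose Qm : {finite_measure set T -> \bar R}%R := HB.pack (mseries q 0) Qf.
exists (cadd (charge_of_finite_measure Pm)
          (copp (charge_of_finite_measure Qm))) => n B mB.
have split_at (m : nat -> measure T R) :
    mseries m 0 B = \sum_(0 <= k < n) m k B + mseries m n B.
  by rewrite /mseries (nneseries_split _ n)// add0n.
have cE : \sum_(0 <= k < n) c k B =
    \sum_(0 <= k < n) p k B - \sum_(0 <= k < n) q k B.
  rewrite -fin_num_sumeN; last by move=> k _; exact: q_fin.
  rewrite -big_split/=; apply: eq_bigr => k _.
  by rewrite (jordan_decomp (hahnPN (c k)) mB) /cadd/= cscaleN1.
have -> : mseries (fun k => tvar (c k)) n B = mseries p n B + mseries q n B.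
  by rewrite /mseries -nneseriesD//.
have Pfin : mseries p 0 B \is a fin_num by apply p_sum_fin.
have Qfin : mseries q 0 B \is a fin_num by apply q_sum_fin.
(* Once the first [n] terms cancel, what is left is the tail of [p] minus the tail of [q], bounded
   in absolute value by their sum. *)
rewrite [X in `|X - _|](_ : _ = mseries p 0 B - mseries q 0 B)// cE.
move: Pfin Qfin; rewrite !split_at.
have : 0 <= mseries p n B by exact: measure_ge0.
have : 0 <= mseries q n B by exact: measure_ge0.
have : \sum_(0 <= k < n) p k B \is a fin_num.
  by rewrite sum_fin_num; apply/allP => x /mapP[k _ ->]; exact: p_fin.
have : \sum_(0 <= k < n) q k B \is a fin_num.
  by rewrite sum_fin_num; apply/allP => x /mapP[k _ ->]; exact: q_fin.
case: (\sum_(0 <= k < n) q k B) => [y| |]// _.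
case: (\sum_(0 <= k < n) p k B) => [x| |]// _.
case: (mseries q n B) => [y'| |]//; case: (mseries p n B) => [x'| |]//.
rewrite !lee_fin => y0 x0 _ _.
have -> : (x + x' - (y + y') - (x - y) = x' - y')%R by ring.
by rewrite (le_trans (ler_normB _ _))// !ger0_norm.
Qed.

Lemma charge_le_setT mu B : (forall C, measurable C -> 0 <= mu C) ->
  measurable B -> mu B <= mu setT.
Proof.
move=> mu0 mB; rewrite -(setUv B) chargeU ?setICr//; last exact: measurableC.
by rewrite leeDl// mu0//; exact: measurableC.
Qed.

(** * Stochastic operators, and equilibria from summable increments *)

Section stochastic.
Variable S : sm -> sm.
Hypothesis hS : stochastic_op S.

Lemma stochastic_op_sub mu mu1 mu2 :
  (forall B, measurable B -> mu B = mu1 B - mu2 B) ->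
  forall B, measurable B -> S mu B = S mu1 B - S mu2 B.
Proof.
move=> muE B mB; have [linS _] := hS.
rewrite (linS 1%R (-1)%R mu1 mu2 mu)//.
  by rewrite lincombE mul1e mulN1e.
by move=> C mC; rewrite muE// lincombE mul1e mulN1e.
Qed.

Lemma stochastic_op_scale (a : R) mu mu1 :
  (forall B, measurable B -> mu B = a%:E * mu1 B) ->
  forall B, measurable B -> S mu B = a%:E * S mu1 B.
Proof.
move=> muE B mB; have [linS _] := hS.
rewrite (linS a 0%R mu1 mu1 mu)//.
  by rewrite lincombE mul0e adde0.
by move=> C mC; rewrite muE// lincombE mul0e adde0.
Qed.

(** Dividing by the total mass reduces to probabilities. If the mass is zero, then [mu] equals
    [0 * mu] on measurable sets and linearity gives [S mu = 0]. *)
Lemma stochastic_op_nonneg mu : (forall B, measurable B -> 0 <= mu B) ->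
  (forall B, measurable B -> 0 <= S mu B) /\ S mu setT = mu setT.
Proof.
move=> mu0; have [_ probS] := hS.
have muT : mu setT \is a fin_num by exact: fin_num_measure.
have [muT0|muT_neq0] := eqVneq (mu setT) 0.
  have SmuE B : measurable B -> S mu B = 0.
    move=> mB; rewrite (@stochastic_op_scale 0%R mu mu) ?mul0e// => C mC.
    by apply/eqP; rewrite mul0e eq_le mu0// andbT -muT0 charge_le_setT.
  by split=> [B mB|]; rewrite SmuE.
pose m := fine (mu setT).
have mE : mu setT = m%:E by rewrite fineK.
have m_gt0 : (0 < m)%R by rewrite -lte_fin -mE lt0e muT_neq0 mu0.
have [Sp0 Sp1] : is_prob (S (cscale m^-1 mu)).
  apply: probS; split=> [B mB|].
    by rewrite cscaleE mule_ge0 ?mu0// lee_fin invr_ge0 ltW.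
  by rewrite cscaleE mE -EFinM mulVf// gt_eqF.
have SmuE : forall B, measurable B -> S mu B = m%:E * S (cscale m^-1 mu) B.
  apply: stochastic_op_scale => B mB.
  by rewrite cscaleE muleA -EFinM divff ?mul1e// gt_eqF.
split=> [B mB|]; last by rewrite SmuE// Sp1 mule1 mE.
by rewrite SmuE// mule_ge0 ?Sp0// lee_fin ltW.
Qed.

(** The Jordan parts of [mu] are sent to nonnegative charges of the same masses, and the variation
    of their difference is at most the sum of these masses. *)
Lemma stochastic_op_tvnorm mu : tvnorm (S mu) <= tvnorm mu.
Proof.
pose p : sm := jordan_pos (hahnPN mu); pose q : sm := jordan_neg (hahnPN mu).
have [Sp0 SpT] : (forall B, measurable B -> 0 <= S p B) /\ S p setT = p setT.
  by apply: stochastic_op_nonneg => B mB; exact: measure_ge0.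
have [Sq0 SqT] : (forall B, measurable B -> 0 <= S q B) /\ S q setT = q setT.
  by apply: stochastic_op_nonneg => B mB; exact: measure_ge0.
have SmuE : forall B, measurable B -> S mu B = S p B - S q B.
  apply: stochastic_op_sub => B mB.
  by rewrite (jordan_decomp (hahnPN mu) mB) /cadd/= cscaleN1.
have [_ _ PN PN0] := hahnPN (S mu).
have [mP mN] := (measurable_hahnP (S mu), measurable_hahnN (S mu)).
rewrite {1}/tvnorm tvarE// !setTI !SmuE//.
have -> : tvnorm mu = p setT + q setT by [].
(* Splitting both masses along the Hahn sets of [S mu] leaves a linear inequality between four
   nonnegative reals. *)
rewrite -SpT -SqT -PN !chargeU//.
have := Sp0 _ mP; have := Sp0 _ mN; have := Sq0 _ mP; have := Sq0 _ mN.
have : S p (hahnP (S mu)) \is a fin_num by exact: fin_num_measure.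
have : S p (hahnN (S mu)) \is a fin_num by exact: fin_num_measure.
have : S q (hahnP (S mu)) \is a fin_num by exact: fin_num_measure.
have : S q (hahnN (S mu)) \is a fin_num by exact: fin_num_measure.
case: (S q (hahnN _)) => [w| |]// _; case: (S q (hahnP _)) => [x| |]// _.
case: (S p (hahnN _)) => [y| |]// _; case: (S p (hahnP _)) => [z| |]// _.
rewrite -!EFinD !lee_fin; lra.
Qed.

Lemma is_prob_iter mu n : is_prob mu -> is_prob (iter n S mu).
Proof. by move=> mu_prob; elim: n => //= n; apply: (hS.2). Qed.

Lemma stochastic_op_increment mu k B : measurable B ->
  iter k S (lincomb 1 (-1) (S mu) mu) B = iter k.+1 S mu B - iter k S mu B.
Proof.
elim: k B => [|k IH] B mB; first by rewrite lincombE mul1e mulN1e.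
by rewrite [LHS]/= (stochastic_op_sub (mu1 := iter k.+1 S mu) (mu2 := iter k S mu)).
Qed.

Lemma sum_stochastic_op_increment mu n B : measurable B ->
  iter n S mu B =
  mu B + \sum_(0 <= k < n) iter k S (lincomb 1 (-1) (S mu) mu) B.
Proof.
move=> mB; elim: n => [|n IH]; first by rewrite big_nil adde0.
rewrite big_nat_recr//= addeA -IH stochastic_op_increment//= addeCA subee ?adde0//.
exact: fin_num_measure.
Qed.

Lemma equilibrium_of_summable W mu :
  measurable_fun setT W -> (forall x, (1 <= W x)%R) ->
  is_prob mu -> in_MW W mu ->
  \sum_(0 <= k <oo) wnorm W (iter k S (lincomb 1 (-1) (S mu) mu)) < +oo ->
  exists mustar, in_MW W mustar /\ equilibrium S mustar.
Proof.
move=> mW W1 mu_prob muW cW.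
pose c k := iter k S (lincomb 1 (-1) (S mu) mu).
have W0 x : (0 <= W x)%R by rewrite (le_trans _ (W1 x)).
have c_tv : \sum_(0 <= k <oo) tvnorm (c k) < +oo.
  apply: le_lt_trans cW; apply: lee_nneseries => k _; first by rewrite tvnorm_ge0.
  exact: tvnorm_le_wnorm.
have [nu nuE] := charge_series c_tv.
pose mustar : sm := cadd mu nu.
(* The tail [m n] of the series of variations controls [mustar - S^n mu] on every measurable set,
   and its mass tends to 0. *)
pose m n : measure T R := mseries (fun k => tvar (c k)) n.
have mustar_m n B : measurable B -> `|mustar B - iter n S mu B| <= m n B.
  move=> mB; rewrite (sum_stochastic_op_increment mu n mB).
  apply: le_trans (nuE n B mB); rewrite [mustar B](_ : _ = mu B + nu B)//.
  rewrite oppeD; last by rewrite fin_num_adde_defr// fin_num_measure.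
  by rewrite addeACA subee ?add0e// fin_num_measure.
have m_cvg : m n setT @[n --> \oo] --> 0.
  by apply: nneseries_tail_cvg => // k _; exact: measure_ge0.
have mE n : m n setT = \sum_(k <oo | (n <= k)%N) tvnorm (c k).
  exact: ereal_series.
have mS n : m n.+1 setT <= m n setT.
  rewrite !mE.
  by apply: subset_lee_nneseries => [k _|k]; [exact: tvnorm_ge0|exact: ltnW].
have small (x : \bar R) (t : R) : (forall n, `|x| <= t%:E * m n setT) -> x = 0.
  move=> xm; apply/eqP; rewrite -abse_eq0 eq_le abse_ge0 andbT.
  rewrite -[leRHS](mule0 t%:E).
  have tm_cvg : t%:E * m n setT @[n --> \oo] --> t%:E * 0 by exact: cvgeZl.
  by apply: (cvge_ge _ tm_cvg); apply: nearW.
have mustar_le n B : measurable B -> `|mustar B - iter n S mu B| <= m n setT.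
  move=> mB; rewrite (le_trans (mustar_m n B mB))//.
  by apply: le_measure => //; rewrite inE.
have mustar_prob : is_prob mustar.
  split=> [B mB|].
    have mustarB : mustar B \is a fin_num by exact: fin_num_measure.
    rewrite leNgt; apply/negP => mustarB0.
    suff : mustar B = 0 by move=> E; rewrite E ltxx in mustarB0.
    apply: (small _ 1%R) => n; rewrite mul1e.
    (* As [S^n mu B >= 0], a negative value [mustar B] is at least [|mustar B|] away from it. *)
    apply: le_trans (mustar_le n B mB).
    have : 0 <= iter n S mu B by exact: (is_prob_iter n mu_prob).1.
    have : iter n S mu B \is a fin_num by exact: fin_num_measure.
    move: mustarB mustarB0; case: (mustar B) => [r| |]// _.
    case: (iter n S mu B) => [s| |]// + _; rewrite !lte_fin !lee_fin => r0 s0.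
    by rewrite (ltr0_norm r0) ler0_norm; lra.
  have mustarT : mustar setT \is a fin_num by exact: fin_num_measure.
  apply: fin_num_sube_eq0 => //; apply: (small _ 1%R) => n; rewrite mul1e.
  rewrite -(is_prob_iter n mu_prob).2; exact: mustar_le.
have S_mustar_le n B : measurable B -> `|S mustar B - iter n.+1 S mu B| <= m n setT.
  (* The setwise bound by [m n] becomes a bound on the total variation of [la], which [S] does not
     increase. *)
  move=> mB; pose la := lincomb 1 (-1) mustar (iter n S mu).
  have laE C : measurable C -> la C = mustar C - iter n S mu C.
    by move=> _; rewrite lincombE mul1e mulN1e.
  rewrite -(stochastic_op_sub laE)//.
  rewrite (le_trans (abse_le_tvnorm _ mB))// (le_trans (stochastic_op_tvnorm _))//.
  by apply: tvar_le_measure => // C mC; rewrite laE//; exact: mustar_m.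
exists mustar; split; last split=> //.
  (* This measure dominates [mustar], and its [W]-integral is [wnorm W mu] plus the convergent sum
     of the [wnorm W (c k)]. *)
  pose mu_m : measure T R := measure_add (tvar mu) (m 0%N).
  have mustar_mu B : measurable B -> `|mustar B| <= mu_m B.
    move=> mB; rewrite [leRHS]measure_addE.
    have muB : mu B \is a fin_num by exact: fin_num_measure.
    rewrite -(subeK (mustar B) muB) (le_trans (lee_abs_add _ _))// addeC leeD//.
      exact: abse_charge_variation.
    exact: mustar_m 0%N B mB.
  apply: le_lt_trans (wnorm_le_measure mW W0 mustar_mu) _.
  have mWE : measurable_fun setT (EFin \o W) by exact/measurable_EFinP.
  rewrite ge0_integral_measure_add//; last by move=> x _; rewrite lee_fin.
  rewrite lte_add_pinfty// ge0_integral_measure_series// => x _.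
  by rewrite lee_fin.
move=> B mB; apply: fin_num_sube_eq0; rewrite ?fin_num_measure//.
(* The factor 2 comes from the triangle inequality through [S^(n+1) mu]: it is within [m n setT] of
   [S mustar], and within [m n.+1 setT <= m n setT] of [mustar]. *)
apply: (small _ 2%R) => n.
have := S_mustar_le n B mB; have := le_trans (mustar_le n.+1 B mB) (mS n).
have : S mustar B \is a fin_num by exact: fin_num_measure.
have : mustar B \is a fin_num by exact: fin_num_measure.
have : iter n.+1 S mu B \is a fin_num by exact: fin_num_measure.
case: (S mustar B) => [x| |]//; case: (mustar B) => [y| |]//.
case: (iter n.+1 S mu B) => [z| |]// _ _ _.
have : 0 <= m n setT by exact: measure_ge0.
case: (m n setT) => [e _| _ _ _|]//; last first.
  by rewrite mulry gtr0_sg// mul1e leey.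
rewrite -!EFinN -!EFinD !abse_EFin -EFinM !lee_fin.
rewrite !ler_norml => /andP[? ?] /andP[? ?]; apply/andP; split; lra.
Qed.

End stochastic.

End signed_measure_lemmas.

(** * Existence of the equilibrium, from the orbit of a Dirac mass *)

Theorem theorem4p4 (d : measure_display) (T : measurableType d) (R : realType)
  (V : T -> R) (phi : R -> R) (S : {charge set T -> \bar R} -> {charge set T -> \bar R}) :
  measurable_fun setT V ->
  (forall x, 1 <= V x) ->
  admissible_rate phi ->
  stochastic_op_on V S ->
  (exists (K varsigma : R), 0 < K /\ 0 < varsigma < 1 /\
    (forall mu, in_MW V mu ->
       (wnorm V (S mu) + varsigma%:E * wnorm (phi \o V) mu
         <= wnorm V mu + K%:E * tvnorm mu)%E) /\
    (exists (N : nat) (gammaH A : R), (1 <= N)%N /\ 0 < gammaH < 1 /\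
       K / varsigma < A /\
       forall nu, is_null_mass nu -> in_MW (phi \o V) nu ->
         (wnorm (phi \o V) nu <= A%:E * tvnorm nu)%E ->
         (tvnorm (iter N S nu) <= gammaH%:E * tvnorm nu)%E)) ->
  exists mustar, in_MW (phi \o V) mustar /\ equilibrium S mustar.
Proof.
move=> mV V1 phiP [hS [SV _]] [K [s [K0 [/andP[s0 _] [drift harris]]]]].
have [N [g [A [_ [g01 [KsA contr]]]]]] := harris.
have V0 x : 0 <= V x by rewrite (le_trans _ (V1 x)).
have mphi := admissible_rate_measurable_comp phiP mV V1.
have phi1 x : 1 <= (phi \o V) x by exact: phiP.2.1.
have phi0 x : 0 <= (phi \o V) x by rewrite (le_trans _ (phi1 x)).
(* The right side of the drift inequality is finite on [in_MW V], hence so is the [phi(V)]-norm, its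
   coefficient on the left being positive. *)
have phi_MW mu : in_MW V mu -> in_MW (phi \o V) mu.
  move=> muV; have := drift mu muV.
  have tv_fin := fin_num_tvnorm mu.
  have : (wnorm V mu + K%:E * tvnorm mu < +oo)%E.
    by rewrite lte_add_pinfty// ltey_eq fin_numM.
  rewrite /in_MW; have := wnorm_ge0 (S mu) V0; have := wnorm_ge0 mu phi0.
  case: (wnorm (phi \o V) mu) => [r| |]//= _ SV0; first by rewrite ltry.
  rewrite gt0_muley ?lte_fin// addey; last by rewrite gt_eqF// (lt_le_trans _ SV0).
  by move=> /[swap] /le_lt_trans /[apply].
(* A Dirac mass lies in [in_MW V] whatever [V] is: its [V]-norm is at most [V x0]. *)
pose x0 : T := point.
pose mu : charge T R := charge_of_finite_measure \d_x0.
have mu_prob : is_prob mu.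
  by split=> [B mB|]; [exact: measure_ge0|exact: probability_setT].
have muV : in_MW V mu.
  have mu_dirac B : measurable B -> (`|mu B| <= (\d_x0 : measure T R) B)%E.
    by move=> mB; rewrite gee0_abs//; exact: measure_ge0.
  apply: le_lt_trans (wnorm_le_measure mV V0 mu_dirac) _.
  by rewrite integral_dirac ?diracT ?mul1e ?ltry//; exact/measurable_EFinP.
pose nu := lincomb 1 (-1) (S mu) mu.
pose c k := iter k S nu.
have nuV : in_MW V nu.
  apply: le_lt_trans (wnorm_le_add (mu1 := S mu) (mu2 := mu) mV V0 _) _.
    move=> B mB; rewrite lincombE mul1e mulN1e; exact: lee_abs_sub.
  by rewrite lte_add_pinfty//; exact: SV.
have cV k : in_MW V (c k) by elim: k => //= k; exact: SV.
have c_null k : is_null_mass (c k).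
  rewrite /is_null_mass /c stochastic_op_increment//.
  rewrite (is_prob_iter hS k.+1 mu_prob).2 (is_prob_iter hS k mu_prob).2.
  by rewrite subee.
(* All three norms of [c k] are finite, so taking [fine] loses nothing and the real-valued estimate
   applies. *)
pose a k := fine (tvnorm (c k)).
pose b k := fine (wnorm (phi \o V) (c k)).
pose v k := fine (wnorm V (c k)).
have aE k : tvnorm (c k) = (a k)%:E by rewrite fineK// fin_num_tvnorm.
have bE k : wnorm (phi \o V) (c k) = (b k)%:E.
  by rewrite fineK// ge0_fin_numE ?wnorm_ge0//; exact: phi_MW.
have vE k : wnorm V (c k) = (v k)%:E.
  by rewrite fineK// ge0_fin_numE ?wnorm_ge0//; exact: cV.
have b0 k : 0 <= b k by rewrite -lee_fin -bE wnorm_ge0.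
have [M bM] : exists M, forall n, \sum_(0 <= k < n) b k <= M.
  apply: (@lyapunov_summable R a b v K s A g N) => // k.
  - by rewrite -lee_fin -aE tvnorm_ge0.
  - by rewrite -lee_fin -vE wnorm_ge0.
  - by have := drift (c k) (cV k); rewrite -[S (c k)]/(c k.+1) aE bE !vE lee_fin.
  - by rewrite -lee_fin -!aE (stochastic_op_tvnorm hS (c k)).
  - move=> bA; rewrite -lee_fin EFinM -!aE /c iterD.
    by apply: contr; [exact: c_null|exact/phi_MW/cV|rewrite -/(c k) aE bE lee_fin].
apply: (@equilibrium_of_summable _ _ _ S hS (phi \o V) mu) => //.
  exact: phi_MW.
apply: (@le_lt_trans _ _ M%:E); last exact: ltry.
apply: lime_le; first by apply: is_cvg_nneseries => k _ _; exact: wnorm_ge0.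
apply: nearW => n; rewrite (eq_bigr (fun k => (b k)%:E)) => [|k _].
  by rewrite sumEFin lee_fin.
exact: bE.
Qed.
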